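(* $17\le M(24)\le 31$.
   Context: For a positive integer $n$, $\tau(n)$ denotes the number of positive divisors of $n$. For a positive integer $k$, $M(k)$ denotes the maximal length of a run of consecutive positive integers each having exactly $k$ divisors, i.e. the largest $L$ for which there is a positive integer $n$ with $\tau(n)=\tau(n+1)=\dots=\tau(n+L-1)=k$. *)

(* Defs.v *)
From mathcomp Require Import all_boot boolp.
Set Implicit Arguments.
Unset Strict Implicit.
Unset Printing Implicit Defensive.

Definition tau (n : nat) : nat := size (divisors n).

Definition has_run (k L : nat) : Prop :=
  exists n : nat, 0 < n /\ forall i : nat, i < L -> tau (n + i) = k.

Lemma has_run0 (k : nat) : exists L, `[< has_run k L >].
Proof. by exists 0; apply/asboolP; exists 1. Qed.

(* Among 2 ^ k + 1 consecutive positive integers one is a multiple of 2 ^ k, *)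
(* hence has more than k divisors.                                           *)
Lemma has_run_bounded (k L : nat) : `[< has_run k L >] -> L <= 2 ^ k.
Proof.
move=> /asboolP[n [n_gt0 run_n]]; rewrite leqNgt; apply/negP => ltL.
pose i := 2 ^ k - n %% 2 ^ k.
have dvd_m : 2 ^ k %| n + i.
  rewrite /dvdn -modnDml /i subnKC ?modnn //.
  by rewrite ltnW // ltn_pmod // expn_gt0.
have /run_n tau_m : i < L by apply: leq_ltn_trans ltL; apply: leq_subr.
have m_gt0 : 0 < n + i by rewrite addn_gt0 n_gt0.
have: size (map (expn 2) (iota 0 k.+1)) <= size (divisors (n + i)).
  apply: uniq_leq_size.
    by rewrite map_inj_uniq ?iota_uniq //; apply: expnI.
  move=> _ /mapP[j + ->]; rewrite mem_iota add0n ltnS => /= le_jk.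
  by rewrite -dvdn_divisors //; apply: dvdn_trans dvd_m; apply: dvdn_exp2l.
by rewrite size_map size_iota -/(tau _) tau_m ltnn.
Qed.

Definition M (k : nat) : nat := ex_maxn (has_run0 k) (@has_run_bounded k).

Lemma M_has_run (k : nat) : has_run k (M k).
Proof. by rewrite /M; case: ex_maxnP => L /asboolP. Qed.

Lemma M_max (k L : nat) : has_run k L -> L <= M k.
Proof. by move=> ?; rewrite /M; case: ex_maxnP => m _; apply; apply/asboolP. Qed.

(* Main.v *)
Require Import Defs.
From Stdlib Require Import NArith.
From mathcomp Require Import all_boot.
Set Implicit Arguments.
Unset Strict Implicit.
Unset Printing Implicit Defensive.

(** Upper bound.  For every v with v + 1 not dividing k, a run of integers with
    k divisors has length less than 2 ^ (v + 1): a longer one would meet the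
    residue class of 2 ^ v modulo 2 ^ (v + 1), whose members are 2 ^ v times an
    odd number and so have a number of divisors divisible by v + 1
    ([M_lt_exp2]).  For k = 24 the least such v is 4, whence M 24 < 32.

    Lower bound.  The 17 integers from [run_start] on have 24 divisors each.
    Their factorisations are listed in [run_factors]; once the listed factors
    are known to be prime, the number of divisors is read off from the exponents
    ([tau_prod_pfactors]).  The factors have up to 40 digits, so their primality
    is proved by Pocklington's criterion ([pocklington]): p is prime as soon as
    a factored divisor F of p - 1 with F ^ 2 >= p comes with a base a whose
    order modulo every prime factor of p is a multiple of F.  The prime factors
    of F are proved prime in the same way, down to primes below 1000;
    [prime_chain] stores all these certificates.  The certificates and the
    factorisations are checked by evaluation on binary integers, and the results
    are transported to [nat] along the coercion [nat_of_bin]. *)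

(** * The number of divisors of a product *)

(** The products d * e with d | m and e | n are the divisors of m * n, without
    repetition: gcd with m and with n recovers d and e from d * e. *)
Lemma tau_coprime m n : 0 < m -> 0 < n -> coprime m n ->
  tau (m * n) = tau m * tau n.
Proof.
move=> m_gt0 n_gt0 co_mn; have mn_gt0 : 0 < m * n by rewrite muln_gt0 m_gt0.
rewrite /tau -(size_allpairs muln); apply/perm_size/uniq_perm.
- exact: divisors_uniq.
- apply: allpairs_uniq; rewrite ?divisors_uniq //.
  have gcd_m d e : d %| m -> e %| n -> gcdn m (d * e) = d.
    move=> dvd_d dvd_e; rewrite mulnC Gauss_gcdr ?(coprime_dvdr dvd_e) //.
    exact/gcdn_idPr.
  have gcd_n d e : d %| m -> e %| n -> gcdn n (d * e) = e.
    move=> dvd_d dvd_e.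
    rewrite Gauss_gcdr ?(coprime_dvdr dvd_d) 1?coprime_sym //.
    exact/gcdn_idPr.
  move=> x y /allpairsP[[d e] /= [d_m e_n ->]].
  move=> /allpairsP[[d' e'] /= [d'_m e'_n ->]] /= eq_de {x y}.
  move: d_m e_n d'_m e'_n; rewrite -!dvdn_divisors // => d_m e_n d'_m e'_n.
  congr pair; [rewrite -(gcd_m d e) // | rewrite -(gcd_n d e) //].
    by rewrite eq_de gcd_m.
  by rewrite eq_de gcd_n.
move=> d; rewrite -dvdn_divisors //; apply/idP/allpairsP => [dvd_d | [[e f]]].
  have g_gt0 : 0 < gcdn d m by rewrite gcdn_gt0 m_gt0 orbT.
  exists (gcdn d m, d %/ gcdn d m) => /=.
  rewrite -!dvdn_divisors // dvdn_gcdr mulnC divnK ?dvdn_gcdl //; split=> //.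
  rewrite -(@Gauss_dvdr _ (m %/ gcdn d m)).
    rewrite -(dvdn_pmul2r g_gt0) divnK ?dvdn_gcdl //.
    by rewrite mulnAC divnK ?dvdn_gcdr.
  rewrite /coprime -(eqn_pmul2r g_gt0) mul1n muln_gcdl.
  by rewrite !divnK ?dvdn_gcdl ?dvdn_gcdr.
by rewrite /= -!dvdn_divisors // => -[e_m f_n ->]; apply: dvdn_mul.
Qed.

Lemma tau_pfactor p e : prime p -> tau (p ^ e) = e.+1.
Proof.
move=> p_pr; have p_gt1 := prime_gt1 p_pr.
rewrite /tau -[RHS](size_iota 0) -[RHS](size_map (expn p)).
apply/perm_size/uniq_perm; rewrite ?divisors_uniq //.
  by rewrite map_inj_uniq ?iota_uniq //; apply: expnI p_gt1.
move=> d; rewrite -dvdn_divisors ?expn_gt0 ?prime_gt0 //.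
apply/(dvdn_pfactor _ _ p_pr)/mapP => -[k].
  by move=> le_ke ->; exists k => //; rewrite mem_iota ltnS.
by rewrite mem_iota ltnS => le_ke ->; exists k.
Qed.

Lemma tau_prod_pfactors (s : seq (nat * nat)) :
    all prime (unzip1 s) -> uniq (unzip1 s) ->
  tau (\prod_(f <- s) f.1 ^ f.2) = \prod_(f <- s) f.2.+1.
Proof.
elim: s => [|[p e] s IHs] /=; first by rewrite !big_nil.
move=> /andP[p_pr s_pr] /andP[p_s s_uniq]; rewrite !big_cons /=.
rewrite -(tau_pfactor e p_pr) -IHs //.
have prod_gt0 : 0 < \prod_(f <- s) f.1 ^ f.2.
  rewrite big_seq prodn_cond_gt0 // => f fs; rewrite expn_gt0.
  by rewrite prime_gt0 // (allP s_pr) // map_f.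
apply: tau_coprime => //; first by rewrite expn_gt0 prime_gt0.
rewrite coprimeXl //.
elim: s s_pr p_s {IHs s_uniq prod_gt0} => [|[q f] s IHs] /=.
  by rewrite big_nil coprimen1.
move=> /andP[q_pr s_pr]; rewrite inE negb_or big_cons /= => /andP[neq_pq p_s].
by rewrite coprimeMr IHs // coprimeXr // prime_coprime // dvdn_prime2 // neq_pq.
Qed.

(** * Pocklington's criterion *)

(** The exponents killing a modulo r are closed under gcd, by a Bezout relation;
    this avoids speaking of the order of a. *)
Lemma expn_gcd_mod1 r a m n : 0 < m ->
  a ^ m = 1 %[mod r] -> a ^ n = 1 %[mod r] -> a ^ gcdn m n = 1 %[mod r].
Proof.
move=> m_gt0 am1 an1; have [u _ /dvdnP[c def_c]] := Bezoutl n m_gt0.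
have : a ^ (c * m) = 1 %[mod r] by rewrite mulnC expnM -modnXm am1 modnXm exp1n.
rewrite -def_c expnD mulnC (mulnC u) expnM -modnMml -modnXm an1 modnXm exp1n.
by rewrite modnMml mul1n.
Qed.

(** Let r be the least prime factor of p, and d the gcd of p - 1 and r - 1.  By
    Fermat a ^ d = 1 modulo r.  If F did not divide d, some prime q dividing F
    would have smaller valuation in d than in p - 1, so d would divide
    (p - 1) / q and r would divide both p and a ^ ((p - 1) / q) - 1, against
    the coprimality hypothesis.  So F divides r - 1, and r ^ 2 > F ^ 2 >= p. *)
Lemma pocklington p F a : 1 < p -> F %| p.-1 -> p <= F ^ 2 ->
    a ^ p.-1 = 1 %[mod p] ->
    (forall q, prime q -> q %| F -> coprime (a ^ (p.-1 %/ q)).-1 p) ->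
  prime p.
Proof.
move=> p_gt1 F_dvd le_pF2 ap1 witness; have p_gt0 := ltnW p_gt1.
have p1_gt0 : 0 < p.-1 by rewrite -subn1 subn_gt0.
have F_gt0 := dvdn_gt0 p1_gt0 F_dvd.
apply: ltn_pdiv2_prime => //; apply: leq_ltn_trans le_pF2 _.
set r := pdiv p; have r_pr : prime r by apply: pdiv_prime.
have r_p : r %| p by apply: pdiv_dvd.
have r_gt1 := prime_gt1 r_pr.
rewrite ltn_sqr -(ltn_predK r_gt1) ltnS dvdn_leq -?subn1 ?subn_gt0 // subn1.
have modr x y : x = y %[mod p] -> x = y %[mod r].
  by move=> eq_xy; rewrite -(modn_dvdm x r_p) eq_xy modn_dvdm.
(* Fermat gives a ^ r = a; the missing inverse of a is a ^ (p - 2). *)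
have ar1 : a ^ r.-1 = 1 %[mod r].
  have /modr ap1r := ap1.
  rewrite -[a ^ r.-1]muln1 -modnMmr -ap1r modnMmr -expnD.
  have -> : r.-1 + p.-1 = r + p.-2.
    by rewrite -(ltn_predK r_gt1) -(ltn_predK p1_gt0) addnS.
  rewrite expnD -modnMml fermat_little // modnMml -expnS.
  by rewrite (ltn_predK p1_gt0).
set d := gcdn p.-1 r.-1.
have d_p1 : d %| p.-1 by apply: dvdn_gcdl.
have ad1 : a ^ d = 1 %[mod r] by apply: expn_gcd_mod1 => //; apply: modr.
apply: dvdn_trans (dvdn_gcdr p.-1 r.-1).
have d_gt0 := dvdn_gt0 p1_gt0 d_p1.
apply/dvdn_partP => // q; rewrite mem_primes => /and3P[q_pr _ q_F].
rewrite p_part pfactor_dvdn // leqNgt; apply/negP => lt_dF.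
(* As v_q(d) < v_q(p - 1), the exponent d still divides (p - 1) / q. *)
have d_p1q : d %| p.-1 %/ q.
  have q_p1 := dvdn_trans q_F F_dvd.
  rewrite dvdn_divRL //; have [c def_c] := dvdnP d_p1.
  have c_gt0 : 0 < c by move: p1_gt0; rewrite def_c muln_gt0 => /andP[].
  rewrite def_c (mulnC c) dvdn_pmul2l //.
  have lt_dp : logn q d < logn q p.-1
    by apply: leq_trans (dvdn_leq_log _ _ F_dvd).
  rewrite -[q]expn1 pfactor_dvdn //.
  by move: lt_dp; rewrite def_c lognM // -[X in X < _]add0n ltn_add2r.
have [c def_c] := dvdnP d_p1q.
have awr : a ^ (p.-1 %/ q) = 1 %[mod r].
  by rewrite def_c mulnC expnM -modnXm ad1 modnXm exp1n.
have a_gt0 : 0 < a ^ (p.-1 %/ q).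
  rewrite lt0n; apply/eqP => a0; move: awr; rewrite a0 mod0n modn_small //.
have : r %| gcdn (a ^ (p.-1 %/ q)).-1 p.
  rewrite dvdn_gcd r_p andbT -subn1 -eqn_mod_dvd //; exact/eqP.
by rewrite (eqP (witness q q_pr q_F)) dvdn1 => /eqP r1; rewrite r1 in r_gt1.
Qed.

(** * Transport from binary integers *)

Lemma nat_of_pos_gt0 p : 0 < nat_of_pos p.
Proof. by elim: p => //= p IHp; rewrite NatTrec.doubleE double_gt0. Qed.

Lemma nat_of_bin_gt0 (b : N) : (0 < b) = (b != 0%num).
Proof. by case: b => // p; apply: nat_of_pos_gt0. Qed.

Lemma nat_of_bin_add (b c : N) : N.add b c = b + c :> nat.
Proof. by case: b c => [|p] [|q] //=; rewrite ?addn0 // nat_of_add_pos. Qed.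

Lemma nat_of_bin_mul (b c : N) : N.mul b c = b * c :> nat.
Proof. by case: b c => [|p] [|q] //=; rewrite ?muln0 // nat_of_mul_pos. Qed.

Lemma nat_of_bin_mod (b m : N) : N.modulo b m = b %[mod m].
Proof.
by rewrite [in RHS](N.div_mod' b m) nat_of_bin_add nat_of_bin_mul mulnC modnMDl.
Qed.

Lemma nat_of_bin_pred (b : N) : N.pred b = b.-1 :> nat.
Proof.
case: (b =P 0%num) => [-> // | /N.succ_pred def_b].
by rewrite -[in RHS]def_b -N.add_1_l nat_of_bin_add.
Qed.

Lemma nat_of_bin_leb (b c : N) : N.leb b c -> b <= c.
Proof.
by move=> /N.leb_spec0 /N.sub_add <-; rewrite nat_of_bin_add leq_addl.
Qed.

Lemma nat_of_bin_coprime (b c : N) : N.gcd b c == 1%num -> coprime b c.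
Proof.
move=> /eqP gcd1; rewrite /coprime -dvdn1.
have [[u [v]]|[u [v]]] := N.gcd_bezout b c; rewrite gcd1;
  move=> /(congr1 nat_of_bin); rewrite nat_of_bin_add !nat_of_bin_mul => bez.
  rewrite -(@dvdn_addl (v * c)) ?dvdn_mull ?dvdn_gcdr //.
  by rewrite -bez dvdn_mull ?dvdn_gcdl.
rewrite -(@dvdn_addl (v * b)) ?dvdn_mull ?dvdn_gcdl //.
by rewrite -bez dvdn_mull ?dvdn_gcdr.
Qed.

(** * Primality certificates *)

Fixpoint powmod_pos (a m : N) (e : positive) : N :=
  match e with
  | xH => N.modulo a m
  | xO e' => let b := powmod_pos a m e' in N.modulo (N.mul b b) m
  | xI e' => let b := powmod_pos a m e' in N.modulo (N.mul a (N.mul b b)) m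
  end.

Lemma powmod_posE (a m : N) e : powmod_pos a m e = a ^ nat_of_pos e %[mod m].
Proof.
elim: e => [e IHe|e IHe|] /=; rewrite nat_of_bin_mod ?nat_of_bin_mul ?expn1 //.
all: set b := powmod_pos a m e in IHe *.
all: have sqr_b : b * b = a ^ (nat_of_pos e).*2 %[mod m]
  by rewrite -modnMm IHe modnMm -addnn expnD.
  by rewrite NatTrec.doubleE expnS -modnMmr sqr_b modnMmr.
by rewrite NatTrec.doubleE.
Qed.

Definition powmod (a m e : N) : N :=
  if e is Npos e' then powmod_pos a m e' else 1%num.

Lemma powmodE (a m e : N) : powmod a m e = a ^ e %[mod m].
Proof. by case: e => [|e] //; apply: powmod_posE. Qed.

Definition prodN (s : seq N) : N := foldr N.mul 1%num s.

Lemma nat_of_bin_prod s : prodN s = \prod_(b <- s) (b : nat) :> nat.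
Proof.
by elim: s => [|b s IHs]; rewrite ?big_nil // big_cons -IHs nat_of_bin_mul.
Qed.

(** A triple (p, a, qs): the prime p, the base a, and the primes, with
    multiplicity, whose product is the divisor F of p - 1. *)
Definition certificate := (N * N * seq N)%type.

(** Every quotient of P = p - 1 is multiplied back and compared with P, which
    tests the divisibility at the same time. *)
Definition certificate_ok (known : pred N) (c : certificate) : bool :=
  let: (p, a, qs) := c in
  let F := prodN qs in
  let P := N.pred p in
  [&& N.leb 2 p, all known qs, N.mul F (N.div P F) == P, N.leb p (N.mul F F),
      powmod a p P == 1%num
    & all (fun q => let e := N.div P q in
             (N.mul q e == P) && (N.gcd (N.pred (powmod a p e)) p == 1%num))
          (undup qs)].

(** Lets the coprimality hypothesis of [pocklington] be tested on the residue of
    a power instead of the power itself.  The value x = 0, where the predecessor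
    is truncated, cannot occur since only 1 is coprime to 0. *)
Lemma coprime_pred_modn p x y : 1 < p -> 0 < y ->
  x = y %[mod p] -> coprime x.-1 p -> coprime y.-1 p.
Proof.
move=> p_gt1 y_gt0 eq_xy; case: x eq_xy => [|x] eq_xy /= co_xp.
  by move: co_xp; rewrite /coprime gcd0n => /eqP p1; rewrite p1 in p_gt1.
rewrite coprime_sym -coprime_modr; suff <- : x = y.-1 %[mod p].
  by rewrite coprime_modr coprime_sym.
by apply/eqP; rewrite -(eqn_modDr 1) !addn1 prednK //; apply/eqP.
Qed.

Lemma certificate_okP (known : pred N) (p a : N) (qs : seq N) :
    (forall q : N, known q -> prime q) ->
  certificate_ok known (p, a, qs) -> prime p.
Proof.
move=> known_pr /and5P[/nat_of_bin_leb p_gt1 /allP qs_known /eqP def_P].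
move=> /nat_of_bin_leb le_pF2 /andP[/eqP ap1 /allP witness].
have qs_pr (q : N) : q \in qs -> prime q by move/qs_known/known_pr.
have ap1_mod : a ^ p.-1 = 1 %[mod p] by rewrite -nat_of_bin_pred -powmodE ap1.
apply: (@pocklington p (prodN qs) a) => //.
- by rewrite -nat_of_bin_pred -def_P nat_of_bin_mul dvdn_mulr.
- by rewrite nat_of_bin_mul in le_pF2; rewrite -mulnn.
move=> r r_pr; rewrite nat_of_bin_prod Euclid_dvd_prod // big_has.
case/hasP=> q qs_q; rewrite dvdn_prime2 ?qs_pr // => /eqP ->.
have /witness/andP[/eqP def_e co_e] : q \in undup qs by rewrite mem_undup.
have q_gt0 := prime_gt0 (qs_pr q qs_q).
rewrite -nat_of_bin_pred -[in N.pred p]def_e nat_of_bin_mul mulKn //.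
move/nat_of_bin_coprime: co_e; rewrite nat_of_bin_pred.
apply: coprime_pred_modn (powmodE _ _ _) => //.
rewrite expn_gt0; case: posnP => //= a0.
move: ap1_mod; rewrite a0 exp0n ?mod0n ?modn_small //.
by rewrite -subn1 subn_gt0.
Qed.

(** Under call-by-value evaluation a conjunction would convert a large [q] to
    unary; the conditional does not. *)
Definition small_prime (q : N) : bool :=
  if N.leb q 1000 then prime q else false.

Definition trusted (cs : seq certificate) (q : N) : bool :=
  small_prime q || (q \in unzip1 (unzip1 cs)).

(** A certificate may rely only on the primes of the certificates after it; this
    order is what rules out circular proofs. *)
Fixpoint chain_ok (cs : seq certificate) : bool :=
  if cs is c :: cs' then certificate_ok (trusted cs') c && chain_ok cs'
  else true.

Lemma chain_okP cs (q : N) : chain_ok cs -> trusted cs q -> prime q.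
Proof.
elim: cs q => [|[[p a] qs] cs IHcs] q cs_ok; rewrite /trusted /small_prime.
  by rewrite orbF; case: ifP.
case/orP; first by case: ifP.
move: cs_ok => /= /andP[c_ok cs_ok]; rewrite inE => /predU1P[-> | cs_q].
  by apply: certificate_okP c_ok => r; apply: IHcs.
by apply: IHcs => //; rewrite /trusted cs_q orbT.
Qed.

(** * Runs of integers with prescribed factorisations *)

Definition factors_as (known : pred N) (n : N) (k : nat) (s : seq (N * nat)) :=
  [&& all known (unzip1 s), uniq (unzip1 s),
      prodN [seq iter f.2 (N.mul f.1) 1%num | f <- s] == n
    & foldr muln 1 [seq f.2.+1 | f <- s] == k].

Lemma tau_factors_as (known : pred N) (n : N) k s :
    (forall q : N, known q -> prime q) ->
  factors_as known n k s -> tau n = k.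
Proof.
move=> known_pr /and4P[/allP s_known s_uniq /eqP <- /eqP <-].
pose t := [seq (nat_of_bin f.1, f.2) | f <- s].
have t1E : unzip1 t = [seq nat_of_bin q | q <- unzip1 s].
  by rewrite /unzip1 -!map_comp.
rewrite foldrE nat_of_bin_prod !big_map.
transitivity (tau (\prod_(f <- t) f.1 ^ f.2)).
  congr tau; rewrite big_map; apply: eq_bigr => -[q e] _ /=.
  by elim: e => //= e IHe; rewrite nat_of_bin_mul IHe expnS.
rewrite tau_prod_pfactors ?big_map // t1E.
  by apply/allP => _ /mapP[q /s_known/known_pr q_pr ->].
by rewrite map_inj_uniq //; apply: can_inj nat_of_binK.
Qed.

Lemma has_run_factorisations cs (n : N) k (rows : seq (seq (N * nat))) :
    n != 0%num -> chain_ok cs ->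
    all (fun i => factors_as (trusted cs) (N.add n (bin_of_nat i)) k
                             (nth [::] rows i))
        (iota 0 (size rows)) ->
  has_run k (size rows).
Proof.
move=> n_neq0 cs_ok /allP rows_ok; exists n; rewrite nat_of_bin_gt0.
split=> // i lt_i; rewrite -[i]bin_of_natK -nat_of_bin_add.
apply: tau_factors_as (rows_ok i _); last by rewrite mem_iota.
by move=> q; apply: chain_okP.
Qed.

(** * The upper bound *)

Lemma M_lt_exp2 v k : ~~ (v.+1 %| k) -> M k < 2 ^ v.+1.
Proof.
apply: contraR; rewrite -leqNgt => le_M.
have [n [n_gt0 run_n]] := M_has_run k.
have d_gt0 e : 0 < 2 ^ e by rewrite expn_gt0.
(* The offset i moves n into the class of 2 ^ v modulo 2 ^ (v + 1). *)
pose i := (2 ^ v + (2 ^ v.+1 - n %% 2 ^ v.+1)) %% 2 ^ v.+1.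
have def_m : (n + i) %% 2 ^ v.+1 = 2 ^ v.
  rewrite modnDmr addnCA -modnDmr -(modnDml n) subnKC ?modnn ?addn0.
    by rewrite modn_small // ltn_exp2l.
  by rewrite ltnW // ltn_pmod.
rewrite -(run_n i); last by apply: leq_trans le_M; rewrite ltn_pmod.
rewrite (divn_eq (n + i) (2 ^ v.+1)) def_m expnSr mulnA mulnAC -mulSnr mulnC.
rewrite tau_coprime ?tau_pfactor ?dvdn_mulr //.
by rewrite coprimeXl // coprime2n /= oddM andbF.
Qed.

(** * The run of length 17 *)

Local Notation "p ^^ e" := (p%num, e%nat) (at level 30, only parsing).

(** The start lies in residue classes that put the square of an odd prime up to
    41 on every term of 2-adic valuation 0, 1 or 3; this gives such a term the
    factor 3 in its number of divisors, which the terms of valuation 2 or 5 owe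
    to their power of 2.  No term has valuation 4, which would make the number
    of divisors a multiple of 5: the only multiple of 16 in the run is
    [run_start] + 4, which is 32 times an odd number. *)
Definition run_start : N := 768369049267672356024049141254832375543516.

Definition run_factors : seq (seq (N * nat)) := [::
  [:: 2^^2; 41047^^1; 44449284079^^1; 105284315902411137115055983^^1];
  [:: 17^^2; 601697^^1; 426420806453^^1; 10362291056766174583433^^1];
  [:: 2^^1; 3^^1; 37^^2; 93543833609407396642810949751014411437^^1];
  [:: 7^^1; 29^^2; 31259^^1; 4175425569259650195904030211773043^^1];
  [:: 2^^5; 5^^1; 4802306557922952225150307132842702347147^^1];
  [:: 3^^2; 74040653^^1; 271437693517^^1; 4248023949796631302769^^1];
  [:: 2^^1; 31^^2; 71^^1; 5630644789521422491419216640931778631^^1];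
  [:: 11^^2; 47159139991^^1; 1431258818623^^1; 94080678371991491^^1];
  [:: 2^^2; 3^^1; 10159^^1; 6302859937556783443449561482879157853^^1];
  [:: 5^^2; 81239^^1; 11077607^^1; 34152250833511421371868073517^^1];
  [:: 2^^1; 7^^2; 11020012489^^1; 711478368155899335085950539083^^1];
  [:: 3^^1; 13^^2; 12693428625414204133^^1; 119394125256257485217^^1];
  [:: 2^^3; 41^^2; 57136306459523524392032208600151128461^^1];
  [:: 19^^2; 4092839^^1; 41499463^^1; 12531282557382740386748977^^1];
  [:: 2^^1; 3^^2; 5^^1; 8537433880751915066933879347275915283817^^1];
  [:: 23^^2; 11949101^^1; 433842413^^1; 280186335801476584936003^^1];
  [:: 2^^2; 19319^^1; 210037^^1; 47340127397857455478880553084361^^1]].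

(** In most entries the divisor F is a single prime above the square root of p,
    which leaves a single coprimality test. *)
Definition prime_chain : seq certificate := [::
  (47340127397857455478880553084361, 2, [:: 734230031414188615632397]);
  (734230031414188615632397, 2, [:: 2889731388503]);
  (2889731388503, 2, [:: 206409384893]);
  (206409384893, 2, [:: 14361911]);
  (14361911, 2, [:: 281; 19]);
  (210037, 2, [:: 761]);
  (19319, 2, [:: 743]);
  (280186335801476584936003, 2, [:: 32028506487667]);
  (32028506487667, 2, [:: 819604547]);
  (819604547, 2, [:: 5771863]);
  (5771863, 2, [:: 320659]);
  (320659, 2, [:: 4111]);
  (4111, 2, [:: 137]);
  (433842413, 2, [:: 108460603]);
  (108460603, 2, [:: 6025589]);
  (6025589, 2, [:: 32051]);
  (32051, 2, [:: 641]);
  (11949101, 2, [:: 19; 19; 5; 5]);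
  (8537433880751915066933879347275915283817, 2,
    [:: 80233007675662685765486423457596377]);
  (80233007675662685765486423457596377, 2, [:: 332786631201977401]);
  (332786631201977401, 2, [:: 11792664413]);
  (11792664413, 2, [:: 2629943]);
  (2629943, 2, [:: 9887]);
  (9887, 2, [:: 4943]);
  (4943, 2, [:: 353]);
  (12531282557382740386748977, 2, [:: 6960171345271]);
  (6960171345271, 2, [:: 2902357]);
  (2902357, 2, [:: 80621]);
  (80621, 2, [:: 139; 2; 2]);
  (41499463, 2, [:: 168697]);
  (168697, 2, [:: 71; 3; 3]);
  (4092839, 2, [:: 2046419]);
  (2046419, 2, [:: 167; 11]);
  (57136306459523524392032208600151128461, 2,
    [:: 18196275942523415411475225668837939]);
  (18196275942523415411475225668837939, 2, [:: 1914598847221663724377]);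
  (1914598847221663724377, 2, [:: 2334869557; 2009810021]);
  (2009810021, 2, [:: 100490501]);
  (100490501, 2, [:: 11; 11; 11; 5; 5]);
  (2334869557, 2, [:: 1487; 43]);
  (1487, 2, [:: 743]);
  (119394125256257485217, 2, [:: 1407418488969463]);
  (1407418488969463, 2, [:: 3552929; 1409]);
  (1409, 3, [:: 2; 2; 2; 2; 2; 2]);
  (3552929, 2, [:: 111029]);
  (111029, 2, [:: 677]);
  (12693428625414204133, 2, [:: 718643973469]);
  (718643973469, 2, [:: 14341; 103]);
  (14341, 2, [:: 239]);
  (711478368155899335085950539083, 2, [:: 167722387589792393938225021]);
  (167722387589792393938225021, 2, [:: 24737815278730441583809]);
  (24737815278730441583809, 2, [:: 6927404049145351]);
  (6927404049145351, 2, [:: 502301; 188021]);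
  (188021, 2, [:: 79; 7]);
  (502301, 2, [:: 5023]);
  (5023, 2, [:: 3; 3; 3; 3]);
  (11020012489, 2, [:: 1404181]);
  (1404181, 2, [:: 269; 3; 3]);
  (34152250833511421371868073517, 2, [:: 65758331; 3502043]);
  (3502043, 2, [:: 157; 19]);
  (65758331, 2, [:: 597803]);
  (597803, 2, [:: 499; 2]);
  (11077607, 2, [:: 35279]);
  (35279, 2, [:: 569]);
  (81239, 7, [:: 151; 2]);
  (6302859937556783443449561482879157853, 2, [:: 1874855408423; 9618241]);
  (9618241, 7, [:: 233; 2; 2; 2; 2]);
  (1874855408423, 2, [:: 8737; 457]);
  (8737, 5, [:: 3; 2; 2; 2; 2; 2]);
  (10159, 2, [:: 1693]);
  (1693, 2, [:: 47]);
  (94080678371991491, 2, [:: 9408067837199149]);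
  (9408067837199149, 2, [:: 2079590591777]);
  (2079590591777, 2, [:: 64987205993]);
  (64987205993, 2, [:: 8123400749]);
  (8123400749, 2, [:: 14610433]);
  (14610433, 5, [:: 2; 2; 2; 2; 2; 2; 2; 2; 2; 2; 2; 2]);
  (1431258818623, 2, [:: 2777; 1381]);
  (1381, 2, [:: 23; 3]);
  (2777, 2, [:: 347]);
  (47159139991, 2, [:: 58379; 5]);
  (58379, 2, [:: 17; 17]);
  (5630644789521422491419216640931778631, 2, [:: 39198606488561260735469]);
  (39198606488561260735469, 2, [:: 626456026474481569]);
  (626456026474481569, 2, [:: 6525583609109183]);
  (6525583609109183, 2, [:: 1854912907649]);
  (1854912907649, 3, [:: 47591; 2; 2; 2; 2; 2]);
  (47591, 2, [:: 4759]);
  (4759, 3, [:: 61; 3]);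
  (4248023949796631302769, 2, [:: 152563; 1049; 1009]);
  (1009, 11, [:: 3; 3; 2; 2]);
  (1049, 2, [:: 131]);
  (152563, 2, [:: 541]);
  (271437693517, 2, [:: 44357; 3; 3; 3]);
  (44357, 2, [:: 853]);
  (74040653, 2, [:: 6311; 2]);
  (6311, 2, [:: 631]);
  (4802306557922952225150307132842702347147, 2,
    [:: 150802983285837941354164160239]);
  (150802983285837941354164160239, 2, [:: 545119624951518357133639]);
  (545119624951518357133639, 2, [:: 2522237; 1812571]);
  (1812571, 2, [:: 1949]);
  (1949, 2, [:: 487]);
  (2522237, 2, [:: 630559]);
  (630559, 2, [:: 11677]);
  (11677, 2, [:: 139]);
  (4175425569259650195904030211773043, 2, [:: 258943671944587514839]);
  (258943671944587514839, 2, [:: 5379194647567151]);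
  (5379194647567151, 2, [:: 220552351]);
  (220552351, 2, [:: 1399; 5; 5]);
  (1399, 2, [:: 233]);
  (31259, 2, [:: 15629]);
  (15629, 2, [:: 3907]);
  (3907, 2, [:: 7; 3; 3]);
  (93543833609407396642810949751014411437, 2,
    [:: 2070507923638073682333331601363]);
  (2070507923638073682333331601363, 2, [:: 1035253961819036841166665800681]);
  (1035253961819036841166665800681, 2, [:: 10249655958683; 53; 53]);
  (10249655958683, 2, [:: 4293269]);
  (4293269, 2, [:: 1433; 2]);
  (1433, 2, [:: 179]);
  (10362291056766174583433, 2, [:: 153089041732155989]);
  (153089041732155989, 2, [:: 38272260433038997]);
  (38272260433038997, 2, [:: 2061638678789]);
  (2061638678789, 2, [:: 4211; 443]);
  (4211, 2, [:: 421]);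
  (426420806453, 2, [:: 2268195779]);
  (2268195779, 2, [:: 1134097889]);
  (1134097889, 2, [:: 460267]);
  (460267, 2, [:: 1871]);
  (1871, 2, [:: 11; 5]);
  (601697, 2, [:: 18803]);
  (18803, 2, [:: 79; 2]);
  (105284315902411137115055983, 2, [:: 1560016677266303]);
  (1560016677266303, 2, [:: 780008338633151]);
  (780008338633151, 2, [:: 718802321]);
  (718802321, 3, [:: 3761; 2; 2; 2]);
  (3761, 3, [:: 5; 2; 2; 2; 2]);
  (44449284079, 2, [:: 2469404671]);
  (2469404671, 2, [:: 28591; 3]);
  (28591, 2, [:: 953]);
  (41047, 2, [:: 6841]);
  (6841, 2, [:: 19; 3; 3])]%num.

Lemma prime_chain_ok : chain_ok prime_chain.
Proof. by vm_compute. Qed.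

Lemma run_factors_ok :
  all (fun i => factors_as (trusted prime_chain)
                           (N.add run_start (bin_of_nat i)) 24
                           (nth [::] run_factors i))
      (iota 0 (size run_factors)).
Proof. by vm_compute. Qed.

Lemma has_run_24_17 : has_run 24 17.
Proof.
have start_neq0 : run_start != 0%num by [].
exact: (has_run_factorisations start_neq0 prime_chain_ok run_factors_ok).
Qed.

Theorem lemma9 : 17 <= M 24 <= 31.
Proof.
have le_M31 : M 24 < 32 := M_lt_exp2 (v := 4) (k := 24) isT.
by rewrite (M_max has_run_24_17) -ltnS le_M31.
Qed.
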